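(* Let $S_1,S_2:[0,1]^2\to[0,1]$ be continuous cancellative t-subnorms with additive generators $s_1:[0,1]\to[s_1(1),\infty]$ and $s_2:[0,1]\to[s_2(1),\infty]$, respectively (normalized, i.e. $s_i(1)=1$, whenever $S_i$ is proper). If the function $x\mapsto\frac{s_1\circ s_2^{-1}(x)}{x}$ is convex on $(s_2(1),\infty)$, then the following are equivalent: (i) $S_1\le S_2$ (pointwise on $[0,1]^2$); (ii) $\displaystyle\lim_{x\to\infty}\frac{s_1\circ s_2^{-1}(x)}{x}=\inf_{x>s_2(1)}\frac{s_1\circ s_2^{-1}(x)}{x}<\infty$.
   Context: A t-subnorm is a binary operation $S:[0,1]^2\to[0,1]$ that is commutative, associative, non-decreasing in both variables and satisfies $S(x,y)\le\min(x,y)$. It is cancellative if $S(x,y)=S(x,z)$ with $x>0$ implies $y=z$. A t-norm is a t-subnorm having $1$ as neutral element; a t-subnorm that is not a t-norm is called proper. By a known representation theorem, a t-subnorm $S$ is continuous and cancellative if and only if there is a continuous, strictly decreasing function $s:[0,1]\to[0,\infty]$ with $s(0)=\infty$ such that $S(x,y)=s^{-1}(s(x)+s(y))$ for all $x,y\in[0,1]$, where $s$ is viewed as a bijection $[0,1]\to[s(1),\infty]$ with inverse $s^{-1}$. Such an $s$ is called an additive generator of $S$; it is unique up to a positive multiplicative constant; $S$ is a (strict) t-norm iff $s(1)=0$ and proper iff $s(1)>0$. When $S$ is proper, its normalized additive generator is the one with $s(1)=1$. *)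

(* Defs.v *)
From HB Require Import structures.
From mathcomp Require Import all_boot all_order all_algebra.
From mathcomp Require Import all_classical all_reals all_analysis.

Set Implicit Arguments.
Unset Strict Implicit.
Unset Printing Implicit Defensive.

Import Order.TTheory GRing.Theory Num.Theory.
Import numFieldNormedType.Exports.

Local Open Scope classical_set_scope.
Local Open Scope ring_scope.

(* Operations on [0,1] are represented by functions on the whole of R; only
   their values on [0,1] (resp. [0,1]^2) are ever constrained or used. *)
Definition unit_itv (R : realType) : set R := `[0, 1].

Record t_subnorm (R : realType) (S : R -> R -> R) : Prop := TSubnorm {
  t_subnorm_itv : forall x y, unit_itv x -> unit_itv y -> unit_itv (S x y) ;
  t_subnormC : forall x y, unit_itv x -> unit_itv y -> S x y = S y x ;
  t_subnormA : forall x y z, unit_itv x -> unit_itv y -> unit_itv z ->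
    S x (S y z) = S (S x y) z ;
  t_subnorm_homo : forall x x' y y',
    unit_itv x -> unit_itv x' -> unit_itv y -> unit_itv y' ->
    x <= x' -> y <= y' -> S x y <= S x' y' ;
  t_subnorm_le_min : forall x y, unit_itv x -> unit_itv y ->
    S x y <= Num.min x y }.

Definition t_norm (R : realType) (S : R -> R -> R) : Prop :=
  t_subnorm S /\ forall x, unit_itv x -> S x 1 = x.

Definition proper_t_subnorm (R : realType) (S : R -> R -> R) : Prop :=
  t_subnorm S /\ ~ t_norm S.

Definition cancellative (R : realType) (S : R -> R -> R) : Prop :=
  forall x y z, unit_itv x -> unit_itv y -> unit_itv z ->
    0 < x -> S x y = S x z -> y = z.

Definition continuous_op (R : realType) (S : R -> R -> R) : Prop :=
  {within @unit_itv R `*` @unit_itv R,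
    continuous (fun p : R * R => S p.1 p.2)}.

(* Inverse of s, seen as a map from [0,1] onto its range; the value 0 outside
   the range is a dummy. *)
Definition gen_inv (R : realType) (s : R -> \bar R) : \bar R -> R :=
  'pinv_(fun=> 0) (@unit_itv R) s.

Record additive_generator (R : realType) (S : R -> R -> R) (s : R -> \bar R) :
    Prop := AdditiveGenerator {
  additive_generator_ge0 : forall x, unit_itv x -> (0 <= s x)%E ;
  additive_generator_continuous : {within @unit_itv R, continuous s} ;
  additive_generator_decr : forall x y, unit_itv x -> unit_itv y ->
    x < y -> (s y < s x)%E ;
  additive_generator0 : s 0 = +oo%E ;
  additive_generatorE : forall x y, unit_itv x -> unit_itv y ->
    S x y = gen_inv s (s x + s y)%E }.

Definition gen_ratio (R : realType) (s1 s2 : R -> \bar R) (x : R) : \bar R :=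
  (s1 (gen_inv s2 x%:E) * (x^-1)%:E)%E.

(* The interval (s(1), oo). *)
Definition gen_dom (R : realType) (s : R -> \bar R) : set R :=
  [set x : R | (s 1%R < x%:E)%E].

(* Main.v *)
(* Put f = s1 \o s2^-1 and g u = f u / u.  Applying the decreasing s1 turns
   S1 <= S2 into subadditivity of f.  A convex g that increases strictly
   somewhere, g u < g v with u < v, satisfies g z >= g v for all z >= v; so g is
   nonincreasing as soon as every bound g u < c is met again at arbitrarily large
   arguments.  Subadditivity gives this through g (2 u) <= g u, and convergence of
   g to its infimum gives it too.  Conversely, a nonincreasing g converges to its
   infimum, and f (u + v) = u g(u + v) + v g(u + v) <= f u + f v. *)
Require Import Defs.
From HB Require Import structures.
From mathcomp Require Import all_boot all_order all_algebra.
From mathcomp Require Import all_classical all_reals all_analysis.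
From mathcomp Require Import ring lra.

Set Implicit Arguments.
Unset Strict Implicit.
Unset Printing Implicit Defensive.

Import Order.TTheory GRing.Theory Num.Theory.
Import numFieldNormedType.Exports.

Local Open Scope classical_set_scope.
Local Open Scope ring_scope.

(** * Intermediate values in the extended reals, and convexity on the line *)

Lemma continuous_contract (R : realType) : continuous (@contract R).
Proof. by move=> x; apply/cvgrPdist_lt => e e0; exact: (nbhsx_ballx x e e0). Qed.

(* [contract] embeds the extended reals into [-1, 1], where the real-valued
   theorem applies. *)
Lemma IVT_ereal (R : realType) (f : R -> \bar R) (a b : R) (v : \bar R) :
  a <= b -> {within `[a, b], continuous f} ->
  (Order.min (f a) (f b) <= v <= Order.max (f a) (f b))%E ->
  exists2 c, c \in `[a, b] & f c = v.
Proof.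
move=> ab fab vab.
have contf : {within `[a, b], continuous (@contract R \o f)}.
  apply: within_continuous_comp fab => x _; exact: continuous_contract.
have [|c cab /contract_inj fc] := IVT ab contf (v := contract v).
  by move: vab; rewrite /= !ge_min !le_max !le_contract.
by exists c.
Qed.

(** Clearing the denominator [z - x] lets the degenerate case [x = z] be included. *)
Lemma convex_function_secant (R : realType) (D : set R) (f : R -> R) x y z :
  @convex_function R R^o D f -> D x -> D z -> x <= y <= z ->
  (z - x) * f y <= (z - y) * f x + (y - x) * f z.
Proof.
move=> cvx Dx Dz /andP[xy yz].
have [xz|zx] := ltP x z; last first.
  have <- : x = y by lra.
  have -> : z = x by lra.
  lra.
have zx0 : 0 < z - x by lra.
have t0 : 0 <= (z - y) / (z - x) by apply: divr_ge0; lra.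
have t1 : (z - y) / (z - x) <= 1 by rewrite ler_pdivrMr //; lra.
have tE : conv (Itv01 t0 t1) (x : R^o) (z : R^o) = y.
  by rewrite convRE /= /unstable.onem; field; rewrite gt_eqF.
have := cvx (Itv01 t0 t1) _ _ (mem_set Dx) (mem_set Dz).
rewrite [X in f X <= _]tE convRE /= /unstable.onem.
move=> /(ler_wpM2l (ltW zx0)) /le_trans; apply.
by rewrite le_eqVlt; apply/orP; left; apply/eqP; field; rewrite gt_eqF.
Qed.

(** Replacing [f x] by the larger [f y] in the secant inequality leaves
    [(y - x) * f y <= (y - x) * f z], where the positive factor cancels. *)
Lemma convex_function_increasing (R : realType) (D : set R) (f : R -> R) x y z :
  @convex_function R R^o D f -> D x -> D z -> x < y -> y <= z ->
  f x < f y -> f y <= f z.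
Proof.
move=> cvx Dx Dz xy yz fxy.
have := convex_function_secant cvx Dx Dz (y := y); rewrite (ltW xy) yz => /(_ isT).
have := ler_wpM2l (x := z - y) _ (ltW fxy); rewrite subr_ge0 => /(_ yz) h1 h2.
by rewrite -(ler_pM2l (x := y - x)) ?subr_gt0//; lra.
Qed.

(** * Additive generators and their inverses *)

Section Generator.
Variables (R : realType) (S : R -> R -> R) (s : R -> \bar R).
Hypothesis genS : additive_generator S s.

Lemma unit_itvP x : reflect (@unit_itv R x) (0 <= x <= 1).
Proof. by rewrite /unit_itv /= in_itv /=; exact: idP. Qed.

Lemma unit_itv0 : @unit_itv R 0. Proof. by rewrite /unit_itv /= in_itv /= lexx ler01. Qed.
Lemma unit_itv1 : @unit_itv R 1. Proof. by rewrite /unit_itv /= in_itv /= lexx ler01. Qed.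

Lemma generator_lt x y : unit_itv x -> unit_itv y -> (s x < s y)%E = (y < x).
Proof.
move=> ux uy; case: (ltgtP y x) => [yx|xy|->]; last by rewrite ltxx.
  by rewrite (additive_generator_decr genS).
by apply/negP/negP; rewrite -leNgt ltW// (additive_generator_decr genS).
Qed.

Lemma generator_le x y : unit_itv x -> unit_itv y -> (s x <= s y)%E = (y <= x).
Proof. by move=> ux uy; rewrite leNgt generator_lt// -leNgt. Qed.

Lemma generator_fin_num x : unit_itv x -> 0 < x -> s x \is a fin_num.
Proof.
move=> ux x0; rewrite ge0_fin_numE ?(additive_generator_ge0 genS)//.
by rewrite -(additive_generator0 genS) generator_lt//; exact: unit_itv0.
Qed.

Lemma generator_ge1 x : unit_itv x -> (s 1 <= s x)%E.
Proof.
by move=> ux; rewrite (generator_le unit_itv1)//; case/unit_itvP/andP: ux.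
Qed.

(** Intermediate values on [0, 1]: the endpoint value [s 0 = +oo] dominates every [y]. *)
Lemma generator_surj y : (s 1 <= y)%E -> (s @` @unit_itv R) y.
Proof.
move=> s1y.
have [|c c01 <-] := IVT_ereal (v := y) (@ler01 R) (additive_generator_continuous genS).
  by rewrite (additive_generator0 genS) ge_min le_max leey s1y orbT.
by exists c.
Qed.

Lemma gen_invK y : (s 1 <= y)%E -> s (gen_inv s y) = y.
Proof. by move=> s1y; apply: pinvK; apply: mem_set; exact: generator_surj. Qed.

Lemma generatorK x : unit_itv x -> gen_inv s (s x) = x.
Proof.
move=> ux; apply: pinvKV; last exact: mem_set.
move=> a b /set_mem ua /set_mem ub sab.
by apply/eqP; rewrite eq_le -!generator_le// sab lexx.
Qed.

Lemma gen_inv_unit y : (s 1 <= y)%E -> unit_itv (gen_inv s y).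
Proof. by move=> /generator_surj[x ux <-]; rewrite generatorK. Qed.

(** The sum stays in the range of [s], since [s x >= s 1] and [s y >= 0]; so the inverse cancels. *)
Lemma generator_op x y : unit_itv x -> unit_itv y -> s (S x y) = (s x + s y)%E.
Proof.
move=> ux uy; rewrite (additive_generatorE genS)// gen_invK//.
by rewrite (le_trans (generator_ge1 ux))// leeDl// (additive_generator_ge0 genS).
Qed.

End Generator.

(** * Order of the operations and the ratio of their generators *)

Section Comparison.
Variables (R : realType) (S1 S2 : R -> R -> R) (s1 s2 : R -> \bar R).
Hypotheses (tS1 : t_subnorm S1) (tS2 : t_subnorm S2).
Hypotheses (genS1 : additive_generator S1 s1) (genS2 : additive_generator S2 s2).

(** With [u = s2 x] and [v = s2 y], the second condition reads f (u + v) <= f u + f v. Stating it in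
    [x] and [y] also covers the points 0 and 1. *)
Lemma le_op_subadditive :
  (forall x y, unit_itv x -> unit_itv y -> S1 x y <= S2 x y) <->
  (forall x y, unit_itv x -> unit_itv y -> (s1 (S2 x y) <= s1 x + s1 y)%E).
Proof.
by split=> le_op x y ux uy; have := le_op x y ux uy;
  rewrite -(generator_op genS1 ux uy) (generator_le genS1)//;
  by [exact: t_subnorm_itv|exact: t_subnorm_itv].
Qed.

Lemma gen_dom_gt0 u : gen_dom s2 u -> 0 < u.
Proof.
rewrite /gen_dom /= -lte_fin; apply: le_lt_trans.
by apply: (additive_generator_ge0 genS2); exact: unit_itv1.
Qed.

Lemma gen_dom_up u v : gen_dom s2 u -> u <= v -> gen_dom s2 v.
Proof. by rewrite /gen_dom /= => s2u uv; rewrite (lt_le_trans s2u)// lee_fin. Qed.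

Lemma gen_dom_inv_unit u : gen_dom s2 u -> unit_itv (gen_inv s2 u%:E).
Proof. by move=> /ltW; exact: (gen_inv_unit genS2). Qed.

Lemma gen_dom_inv_gt0 u : gen_dom s2 u -> 0 < gen_inv s2 u%:E.
Proof.
move=> Du; rewrite -(generator_lt genS2) ?(gen_invK genS2) ?(ltW Du)//.
- by rewrite (additive_generator0 genS2) ltry.
- exact: gen_dom_inv_unit.
- exact: unit_itv0.
Qed.

(** A finite [u] comes from a point other than 0, and 0 is the only point where [s1] is infinite. *)
Lemma gen_dom_fin_num u : gen_dom s2 u -> s1 (gen_inv s2 u%:E) \is a fin_num.
Proof.
move=> Du; apply: (generator_fin_num genS1); first exact: gen_dom_inv_unit.
exact: gen_dom_inv_gt0.
Qed.

Lemma gen_dom_generator x : unit_itv x -> 0 < x -> x < 1 ->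
  gen_dom s2 (fine (s2 x)).
Proof.
move=> ux x0 x1; rewrite /gen_dom /= fineK ?(generator_fin_num genS2)//.
by rewrite (generator_lt genS2)//; exact: unit_itv1.
Qed.

Lemma gen_ratioE u : gen_dom s2 u ->
  gen_ratio s1 s2 u = (fine (s1 (gen_inv s2 u%:E)) / u)%:E.
Proof. by move=> Du; rewrite /gen_ratio EFinM fineK// gen_dom_fin_num. Qed.

Lemma gen_dom_inv_op u v : gen_dom s2 u -> gen_dom s2 v ->
  gen_inv s2 (u + v)%:E = S2 (gen_inv s2 u%:E) (gen_inv s2 v%:E).
Proof.
move=> Du Dv.
have uu := gen_dom_inv_unit Du; have uv := gen_dom_inv_unit Dv.
rewrite -[RHS](generatorK genS2); last exact: t_subnorm_itv.
by rewrite (generator_op genS2)// !(gen_invK genS2)// ltW.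
Qed.

(** Subadditivity at two equal arguments gives f (2 u) <= 2 f u; divide by 2 u. *)
Lemma gen_ratio_double u :
  (forall x y, unit_itv x -> unit_itv y -> (s1 (S2 x y) <= s1 x + s1 y)%E) ->
  gen_dom s2 u -> (gen_ratio s1 s2 (u + u) <= gen_ratio s1 s2 u)%E.
Proof.
move=> subadd Du; have u0 := gen_dom_gt0 Du.
have Duu : gen_dom s2 (u + u) by apply: (gen_dom_up Du); rewrite lerDl ltW.
have := subadd _ _ (gen_dom_inv_unit Du) (gen_dom_inv_unit Du).
rewrite !gen_ratioE// -gen_dom_inv_op//.
rewrite -(fineK (gen_dom_fin_num Du)) -(fineK (gen_dom_fin_num Duu)) /=.
rewrite -EFinD !lee_fin => fuu.
rewrite ler_pdivrMr ?addr_gt0// mulrDr -!mulrA mulVf ?mulr1//.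
by rewrite gt_eqF.
Qed.

Lemma gen_ratio_double_iter u n :
  (forall x y, unit_itv x -> unit_itv y -> (s1 (S2 x y) <= s1 x + s1 y)%E) ->
  gen_dom s2 u ->
  gen_dom s2 (2 ^+ n * u) /\
  (gen_ratio s1 s2 (2 ^+ n * u) <= gen_ratio s1 s2 u)%E.
Proof.
move=> subadd Du; elim: n => [|n [Dn le_n]]; first by rewrite expr0 mul1r.
have -> : 2 ^+ n.+1 * u = 2 ^+ n * u + 2 ^+ n * u by rewrite exprS; ring.
split; last exact: (le_trans (gen_ratio_double subadd Dn)).
by apply: (gen_dom_up Dn); rewrite lerDl ltW// gen_dom_gt0.
Qed.

Lemma gen_ratio_recurrent :
  (forall x y, unit_itv x -> unit_itv y -> (s1 (S2 x y) <= s1 x + s1 y)%E) ->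
  forall u c, gen_dom s2 u -> (gen_ratio s1 s2 u < c)%E ->
  forall m, exists2 z, m <= z & (gen_ratio s1 s2 z < c)%E.
Proof.
move=> subadd u c Du uc m; have u0 := gen_dom_gt0 Du.
(* For this [n], m / u <= n <= 2 ^ n, so [n] doublings carry [u] to [m] or beyond. *)
pose n := Num.bound `|m / u|.
have [_ le_n] := gen_ratio_double_iter n subadd Du.
exists (2 ^+ n * u); last exact: le_lt_trans uc.
rewrite -ler_pdivrMr// (le_trans (ler_norm _))//.
rewrite (le_trans (ltW (archi_boundP (normr_ge0 _))))//.
by rewrite -natrX ler_nat ltnW// ltn_expl.
Qed.

(** * Monotonicity of the ratio and its consequences *)

Hypothesis cvx : @convex_function R R^o (gen_dom s2)
  (fun x => fine (gen_ratio s1 s2 x)).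

Lemma gen_ratio_nincr :
  (forall u c, gen_dom s2 u -> (gen_ratio s1 s2 u < c)%E ->
    forall m, exists2 z, m <= z & (gen_ratio s1 s2 z < c)%E) ->
  forall u v, gen_dom s2 u -> u <= v ->
  (gen_ratio s1 s2 v <= gen_ratio s1 s2 u)%E.
Proof.
move=> rec u v Du; rewrite le_eqVlt => /orP[/eqP->//|uv].
rewrite leNgt; apply/negP => lt_uv.
have Dv := gen_dom_up Du (ltW uv).
(* The bound is the value at [v] itself: some [z >= v] has a ratio strictly below it, which
   convexity forbids after the increase from [u] to [v]. *)
have [z vz] := rec _ _ Du lt_uv v.
have Dz := gen_dom_up Dv vz.
have := convex_function_increasing cvx Du Dz uv vz.
move: lt_uv; rewrite !gen_ratioE//= !lte_fin => lt_uv /(_ lt_uv).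
by rewrite leNgt => /negP.
Qed.

Lemma nincr_gen_ratio_cvg :
  (forall u v, gen_dom s2 u -> u <= v ->
    (gen_ratio s1 s2 v <= gen_ratio s1 s2 u)%E) ->
  gen_ratio s1 s2 x @[x --> +oo] -->
    ereal_inf (gen_ratio s1 s2 @` gen_dom s2)
  /\ (ereal_inf (gen_ratio s1 s2 @` gen_dom s2) < +oo)%E.
Proof.
move=> nincr.
(* As [s2 1] is finite, the domain contains this point; its ratio bounds the infimum, and all larger
   reals lie in the domain too. *)
have D0 : gen_dom s2 (fine (s2 1) + 1).
  have s21 := generator_fin_num genS2 (unit_itv1 R) ltr01.
  by rewrite /gen_dom /= EFinD fineK// lteDl// lte01.
split; last first.
  apply: (@le_lt_trans _ _ (gen_ratio s1 s2 (fine (s2 1) + 1))).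
    by apply: ereal_inf_lbound; exists (fine (s2 1) + 1).
  by rewrite gen_ratioE// ltry.
(* Since the domain is closed upwards, extension by [+oo] is nonincreasing on the whole line, and it
   keeps the infimum; monotone convergence then applies. *)
pose h u := if u \in gen_dom s2 then gen_ratio s1 s2 u else +oo%E.
have -> : ereal_inf (gen_ratio s1 s2 @` gen_dom s2) = ereal_inf (range h).
  apply/eqP; rewrite eq_le; apply/andP; split; apply: le_ereal_inf_tmp => _ [u Du <-].
    rewrite /h; case: ifPn => [/set_mem Du'|_]; last exact: leey.
    by apply: ereal_inf_lbound; exists u.
  by apply: ereal_inf_lbound; exists u => //; rewrite /h mem_set.
apply: cvg_trans; last first.
  apply: (@nonincreasing_cvge _ h) => u v uv; rewrite /h.
  have [/set_mem Du|_] := boolP (u \in gen_dom s2); last exact: leey.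
  by rewrite mem_set; [exact: nincr|exact: gen_dom_up uv].
apply: near_eq_cvg; near=> u; rewrite /h mem_set//.
by apply: (gen_dom_up D0); near: u; apply: nbhs_pinfty_ge; exact: num_real.
Unshelve. all: by end_near. Qed.

(* Points of (0, 1] are approximated from inside (0, 1), because the ratio only
   controls arguments u > s2 1, that is, points x < 1. *)
Lemma generator_approx x e : unit_itv x -> 0 < x -> 0 < e ->
  exists x', [/\ unit_itv x', 0 < x', x' < 1, x' <= x & (s1 x' = s1 x + e%:E)%E].
Proof.
move=> ux x0 e0; have sx := generator_fin_num genS1 ux x0.
have sxe : (s1 x < s1 x + e%:E)%E by rewrite lteDl// lte_fin.
have s1x : (s1 1 <= s1 x + e%:E)%E.
  by rewrite (le_trans (generator_ge1 genS1 ux))// ltW.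
have ux' := gen_inv_unit genS1 s1x.
have x'x : gen_inv s1 (s1 x + e%:E) < x.
  by rewrite -(generator_lt genS1)// (gen_invK genS1).
exists (gen_inv s1 (s1 x + e%:E)); split => //.
- rewrite -(generator_lt genS1)//; last exact: unit_itv0.
  by rewrite (gen_invK genS1)// (additive_generator0 genS1) -(fineK sx) ltry.
- by apply: (lt_le_trans x'x); case/unit_itvP/andP: ux.
- exact: ltW.
- exact: (gen_invK genS1).
Qed.

Lemma nincr_gen_ratio_subadditive :
  (forall u v, gen_dom s2 u -> u <= v ->
    (gen_ratio s1 s2 v <= gen_ratio s1 s2 u)%E) ->
  forall x y, unit_itv x -> unit_itv y -> (s1 (S2 x y) <= s1 x + s1 y)%E.
Proof.
move=> nincr.
(* For [x] and [y] in (0, 1), both [s2 x] and [s2 y] are real and lie in the domain of the ratio. *)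
have subadd x y : unit_itv x -> unit_itv y -> 0 < x -> x < 1 -> 0 < y -> y < 1 ->
    (s1 (S2 x y) <= s1 x + s1 y)%E.
  move=> ux uy x0 x1 y0 y1.
  have fx := generator_fin_num genS2 ux x0; have fy := generator_fin_num genS2 uy y0.
  have := gen_dom_generator ux x0 x1; have := gen_dom_generator uy y0 y1.
  have := generatorK genS2 ux; have := generatorK genS2 uy.
  rewrite -{1}(fineK fx) -{1}(fineK fy).
  move: (fine _) (fine _) => u v yE xE Dv Du.
  have u0 := gen_dom_gt0 Du; have v0 := gen_dom_gt0 Dv.
  have uuv : u <= u + v by rewrite lerDl ltW.
  have vuv : v <= u + v by rewrite lerDr ltW.
  have Duv := gen_dom_up Du uuv.
  rewrite -{1}xE -{1}yE -gen_dom_inv_op// -xE -yE.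
  have := nincr _ _ Du uuv; have := nincr _ _ Dv vuv; rewrite !gen_ratioE//.
  rewrite -(fineK (gen_dom_fin_num Du)) -(fineK (gen_dom_fin_num Dv)).
  rewrite -(fineK (gen_dom_fin_num Duv)) -EFinD !lee_fin /=.
  move: (fine _) (fine _) (fine _) => fu fv fuv hv hu.
  have -> : fuv = fuv / (u + v) * u + fuv / (u + v) * v.
    by field; rewrite gt_eqF// addr_gt0.
  by apply: lerD; rewrite -ler_pdivlMr.
move=> x y ux uy.
have s1_nnoo z : unit_itv z -> s1 z != -oo%E.
  by move=> uz; rewrite gt_eqF// (lt_le_trans ltNy0)// (additive_generator_ge0 genS1).
(* If [x] or [y] is 0, the right-hand side is [+oo]. *)
have [x0|x0] := leP x 0.
  have -> : x = 0 by apply/eqP; rewrite eq_le x0; case/unit_itvP/andP: ux.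
  by rewrite (additive_generator0 genS1) addye ?s1_nnoo// leey.
have [y0|y0] := leP y 0.
  have -> : y = 0 by apply/eqP; rewrite eq_le y0; case/unit_itvP/andP: uy.
  by rewrite (additive_generator0 genS1) addey ?s1_nnoo// leey.
(* The value 1 remains possible: moving each argument down raises its [s1] by [e / 2], while
   [s1 (S2 x y)] can only grow. *)
apply/lee_addgt0Pr => e e0.
have e20 : 0 < e / 2 by rewrite divr_gt0.
have [x' [ux' x'0 x'1 x'x sx']] := generator_approx ux x0 e20.
have [y' [uy' y'0 y'1 y'y sy']] := generator_approx uy y0 e20.
apply: (@le_trans _ _ (s1 (S2 x' y'))).
  rewrite (generator_le genS1); try exact: t_subnorm_itv.
  exact: t_subnorm_homo.
rewrite (le_trans (subadd _ _ ux' uy' x'0 x'1 y'0 y'1))// sx' sy'.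
by rewrite addeACA -EFinD -splitr.
Qed.

(** The infimum is below [c], so the open ray below [c] is a neighbourhood of the limit and
    eventually contains the ratio. *)
Lemma gen_ratio_cvg_recurrent :
  gen_ratio s1 s2 x @[x --> +oo] -->
    ereal_inf (gen_ratio s1 s2 @` gen_dom s2) ->
  forall u c, gen_dom s2 u -> (gen_ratio s1 s2 u < c)%E ->
  forall m, exists2 z, m <= z & (gen_ratio s1 s2 z < c)%E.
Proof.
move=> lim_inf u c Du uc m.
have infc : (ereal_inf (gen_ratio s1 s2 @` gen_dom s2) < c)%E.
  by apply: le_lt_trans uc; apply: ereal_inf_lbound; exists u.
apply: pinfty_ex_ge; first exact: num_real.
apply: (lim_inf [set y | (y < c)%E]).
by apply: open_nbhs_nbhs; split => //; exact: open_ereal_lt_ereal.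
Qed.

End Comparison.

Theorem theorem4p1 (R : realType) (S1 S2 : R -> R -> R) (s1 s2 : R -> \bar R)
  (tS1 : t_subnorm S1) (tS2 : t_subnorm S2)
  (contS1 : continuous_op S1) (contS2 : continuous_op S2)
  (cancS1 : cancellative S1) (cancS2 : cancellative S2)
  (genS1 : additive_generator S1 s1) (genS2 : additive_generator S2 s2)
  (normS1 : proper_t_subnorm S1 -> s1 1 = 1%E)
  (normS2 : proper_t_subnorm S2 -> s2 1 = 1%E)
  (* on (s2(1), oo) the ratio is finite, so that fine loses nothing *)
  (cvx : @convex_function R R^o (gen_dom s2)
           (fun x => fine (gen_ratio s1 s2 x))) :
  (forall x y, unit_itv x -> unit_itv y -> S1 x y <= S2 x y)
  <->
  (gen_ratio s1 s2 x @[x --> +oo%R]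
     --> ereal_inf (gen_ratio s1 s2 @` gen_dom s2)
   /\ (ereal_inf (gen_ratio s1 s2 @` gen_dom s2) < +oo)%E).
Proof.
rewrite (le_op_subadditive tS1 tS2 genS1); split => [subadd|[lim_inf _]].
  apply: (nincr_gen_ratio_cvg genS1 genS2).
  apply: (gen_ratio_nincr genS1 genS2 cvx).
  exact: (gen_ratio_recurrent tS2 genS1 genS2).
apply: (nincr_gen_ratio_subadditive tS2 genS1 genS2).
apply: (gen_ratio_nincr genS1 genS2 cvx).
exact: gen_ratio_cvg_recurrent lim_inf.
Qed.
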